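(* Let $m \geq 1$ and $n \geq 1$ be integers. The generating function of the statistic $\mathtt{pinv}$ on $\mathbb{U}_m \wr \mathfrak{S}_n$ is $$\sum_{\pi \in \mathbb{U}_m \wr \mathfrak{S}_n} q^{\mathtt{pinv}\,\pi} = \prod_{i=1}^n [mi]_q.$$
   Context: $\mathfrak{S}_n$ is the symmetric group on $[n]=\{1,\dots,n\}$, $\mathbb{U}_m$ is the group of $m$-th roots of unity, and $\mathbb{U}_m \wr \mathfrak{S}_n$ is their wreath product (the colored permutation group of $m$ colors and $n$ elements). An element $\pi \in \mathbb{U}_m \wr \mathfrak{S}_n$ is represented as $\pi = \begin{pmatrix} 1 & 2 & \dots & n\\ \zeta_{k_1}\sigma(1) & \zeta_{k_2}\sigma(2) & \dots & \zeta_{k_n}\sigma(n)\end{pmatrix}$ with $\sigma \in \mathfrak{S}_n$, $\zeta_{k_j} = e^{2\pi \sqrt{-1}\, k_j/m}$ and $k_j \in \{0,1,\dots,m-1\}$; thus $\pi$ amounts to a pair consisting of $\sigma\in\mathfrak{S}_n$ and $(k_1,\dots,k_n)\in\{0,\dots,m-1\}^n$. For $i \in [n]$, the number of $i$-pseudoinversions of $\pi$ is $$\mathtt{pinv}_i\,\pi := k_i(n-i+1) + \big|\{j \in \{i+1,\dots,n\} \mid \sigma(i) > \sigma(j)\}\big|,$$ and the number of pseudoinversions of $\pi$ is $\mathtt{pinv}\,\pi := \sum_{i=1}^n \mathtt{pinv}_i\,\pi$. Here $q$ is an indeterminate and $[i]_q := 1 + q + \dots + q^{i-1}$ denotes the $q$-analog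 of the positive integer $i$. *)

(* Defs.v *)
From mathcomp Require Import all_boot all_order all_fingroup all_algebra.

Set Implicit Arguments.
Unset Strict Implicit.
Unset Printing Implicit Defensive.

Import GRing.Theory.
Local Open Scope ring_scope.

(* The underlying set of the wreath product of the m-th roots of unity by 'S_n:
   (sigma, k) stands for the colored permutation i |-> zeta_(k i) * sigma i,
   with zeta_k = exp (2 pi sqrt(-1) k / m). *)
Definition colored_perm (m n : nat) : finType :=
  ('S_n * {ffun 'I_n -> 'I_m})%type.

Definition perm_of m n (pi : colored_perm m n) : 'S_n := pi.1.

Definition color m n (pi : colored_perm m n) (i : 'I_n) : nat := pi.2 i.

(* Indices are shifted by one: i : 'I_n is the position i.+1 of {1, ..., n},
   so that the factor n - (i.+1) + 1 is n - i. *)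
Definition pinv_at m n (pi : colored_perm m n) (i : 'I_n) : nat :=
  (color pi i * (n - i)
   + #|[set j : 'I_n | (i < j) && (perm_of pi j < perm_of pi i)]|)%N.

Definition pinv m n (pi : colored_perm m n) : nat :=
  (\sum_(i < n) pinv_at pi i)%N.

Definition qint (i : nat) : {poly int} := \sum_(j < i) 'X^j.

(* Main.v *)
(** The weight of (sigma, k) splits as q^(inv sigma) times the product of the
    q^(k_i (n - i + 1)). Summing over the colors gives the product of the
    [m]_(q^i), and summing over sigma gives the product of the [i]_q
    (Rodrigues), by removing the first letter sigma(1) = j, which creates
    exactly j - 1 inversions. Finally [i]_q [m]_(q^i) = [m i]_q. *)
Require Import Defs.
From mathcomp Require Import all_boot all_order all_fingroup all_algebra.

Import GRing.Theory.
Local Open Scope ring_scope.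

Definition inv_at {n} (s : 'S_n) (i : 'I_n) : nat :=
  #|[set j : 'I_n | (i < j) && (s j < s i)]|%N.

Lemma inv_atE n (s : 'S_n) i :
  inv_at s i = (\sum_(j < n) ((i < j) && (s j < s i)))%N.
Proof.
rewrite /inv_at -sum1dep_card big_mkcond.
by apply: eq_bigr => j _; case: ifP.
Qed.

(** As [v] varies, [lift j v] takes each value other than [j] once. *)
Lemma sum_lift_lt n (j : 'I_n.+1) : (\sum_(v < n) (lift j v < j) = j)%N.
Proof.
have -> : (\sum_(v < n) (lift j v < j) = \sum_(v < n | v < j) 1)%N.
  rewrite [RHS]big_mkcond; apply: eq_bigr => v _ /=.
  rewrite /bump; case: (leqP j v) => [jv|->] //.
  by rewrite add1n ltnNge (leqW jv).
by rewrite -(big_ord_widen _ (fun=> 1%N) (ltn_ord j : (j <= n)%N)) sum1_card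
  card_ord.
Qed.

(** The first letter [j], counted from 0, exceeds exactly [j] later letters. Elsewhere the
    inversions are those of [s], since [lift] preserves order and position 0 follows no other. *)
Lemma inv_lift_perm n (j : 'I_n.+1) (s : 'S_n) :
  (\sum_i inv_at (lift_perm ord0 j s) i = j + \sum_i inv_at s i)%N.
Proof.
have lt_lift (h : 'I_n.+1) (a b : 'I_n) : (lift h a < lift h b)%N = (a < b)%N.
  by rewrite !ltnNge /= leq_bump2.
rewrite big_ord_recl; congr (_ + _)%N.
  rewrite inv_atE big_ord_recl /= add0n lift_perm_id.
  under eq_bigr do rewrite lift_perm_lift.
  by rewrite -[RHS]sum_lift_lt [RHS](reindex_inj (@perm_inj _ s)).
apply: eq_bigr => i _; rewrite !inv_atE big_ord_recl ltn0 add0n.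
by apply: eq_bigr => k _; rewrite !lift_perm_lift !lt_lift.
Qed.

(** The image of [ord0] recovers [j], hence injectivity; the cardinals agree as (n+1) n! =
    (n+1)!. *)
Lemma lift_perm_bij n :
  bijective (fun p : 'I_n.+1 * 'S_n => lift_perm ord0 p.1 p.2).
Proof.
apply: inj_card_bij; last by rewrite card_prod card_ord !card_Sn factS.
move=> [j s] [k t] /= e.
have ejk : j = k by rewrite -(lift_perm_id ord0 j s) e lift_perm_id.
rewrite -{k}ejk in e *; congr (_, _); apply/permP => x.
by apply: (@lift_inj _ j); rewrite -!(lift_perm_lift ord0) e.
Qed.

Lemma sum_inv (R : comNzRingType) (q : R) n :
  \sum_(s : 'S_n) q ^+ (\sum_i inv_at s i)%N
    = \prod_(1 <= i < n.+1) \sum_(j < i) q ^+ j.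
Proof.
elim: n => [|n IHn].
  rewrite big_geq // (big_pred1 1%g) ?big_ord0 // => s.
  by apply/esym/eqP/permP => -[].
rewrite (reindex _ (onW_bij _ (lift_perm_bij n))) /=.
rewrite big_nat_recr //= -IHn mulrC big_distrlr pair_big /=.
by apply: eq_bigr => -[j s] _ /=; rewrite inv_lift_perm exprD.
Qed.

(** The exponents below [m * i] form [m] blocks of length [i], block [k] starting at [k * i]. *)
Lemma qintM m i : qint (m * i) = (\sum_(j < i) 'X^j) * \sum_(k < m) 'X^(k * i).
Proof.
rewrite /qint; elim: m => [|m IHm]; first by rewrite !big_ord0 mulr0.
rewrite mulSn addnC big_split_ord IHm [in RHS]big_ord_recr mulrDr /=.
congr (_ + _); rewrite mulr_suml.
by apply: eq_bigr => j _; rewrite -exprD addnC.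
Qed.

Theorem corollary1p7 (m n : nat) (hm : (1 <= m)%N) (hn : (1 <= n)%N) :
  \sum_(pi : colored_perm m n) 'X^(pinv pi)
    = \prod_(1 <= i < n.+1) qint (m * i) :> {poly int}.
Proof.
under [RHS]eq_bigr do rewrite qintM.
rewrite big_split /= -sum_inv.
have -> : \prod_(1 <= i < n.+1) \sum_(k < m) 'X^(k * i)
    = \sum_(c : {ffun 'I_n -> 'I_m}) \prod_i 'X^(c i * (n - i)) :> {poly int}.
  rewrite -(bigA_distr_bigA (fun (i : 'I_n) (k : 'I_m) => 'X^(k * (n - i)))).
  (* Reversing the positions turns [i.+1] into [n - i], the weight of a color at position [i]. *)
  rewrite big_add1 big_mkord (reindex_inj rev_ord_inj).
  by apply: eq_bigr => i _; rewrite /= subnSK.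
rewrite big_distrlr pair_big /=.
apply: eq_bigr => -[s c] _.
by rewrite /pinv big_split exprD mulrC -expr_sum.
Qed.
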